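(* Let $\|\cdot\|_O$ be an observer's norm with associated scattering norm $\|\cdot\|_S$ and scattering spaces $S(C)$. Let $f$ be a uniform scattering solution, relative to $\|\cdot\|_O$, of $\partial_t f+\xi\cdot\nabla_x f=I(f,x,\xi,t)$, $f(x,\xi,0)=f_0(x,\xi)$, and let $$N=\|f(x,\xi,0)\|_O+\Big\|\int_0^\infty|I(f,x+t\xi,\xi,t)|\,dt\Big\|_O<\infty.$$ Then there exists a unique solution $f_\infty\in S(N)$ of the linear transport equation $\partial_t f_\infty+\xi\cdot\nabla_x f_\infty=0$ such that $$\lim_{t\to\infty}\big\|f(x+t\xi,\xi,t)-f_\infty(x,\xi,0)\big\|_O=0.$$
   Context: Here $x,\xi\in\mathbb{R}^n$, $t\in[0,\infty)$. The equation is equivalently understood along characteristics, i.e. $f(x+t\xi,\xi,t)=f_0(x,\xi)+\int_0^t I(f,x+s\xi,\xi,s)\,ds$; $f$ is expected to be non-negative. $I(f,x,\xi,t)$ is a mesoscopic interaction, meaning $\int_{\mathbb{R}^n} I(f,x,\xi,t)\,d\xi=0$, $\int_{\mathbb{R}^n} I(f,x,\xi,t)|\xi|^2\,d\xi=0$ and $\int_{\mathbb{R}^n} I(f,x,\xi,t)\xi_i\,d\xi=0$ for $1\le i\le n$. Observer's norm: a norm $\|\cdot\|_O$ acting on the $(x,\xi)$ variables for fixed time $t$ (so its value $\|f\|_O(t)$ may depend on $t$), such that if $\|f\|_O(t)<\infty$ then the interaction $I(f,x,\xi,t)$ is well defined and $\iint f(x,\xi,t)\,dx\,d\xi$, $\iint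 f(x,\xi,t)\xi\,dx\,d\xi$, $\iint f(x,\xi,t)|\xi|^2\,dx\,d\xi$ are convergent. Scattering norm: $\|f\|_S=\sup_t\|f(x+t\xi,\xi,t)\|_O$. Scattering space: for $C>0$, $f\in S(C)$ if and only if $\|f\|_S\le C$; $S(C)$ is identified with its completion. Uniform scattering solution relative to $\|\cdot\|_O$: a solution $f$ with $\|f(x,\xi,0)\|_O+\big\|\int_0^\infty|I(f,x+t\xi,\xi,t)|\,dt\big\|_O<\infty$ and $\lim_{z\to\infty}\big\|\int_z^\infty|I(f,x+t\xi,\xi,t)|\,dt\big\|_O=0$.
   Formalization: The observer's norm is additionally assumed to satisfy ‖g‖_O ≤ ‖h‖_O whenever |g| ≤ h almost everywhere; without such compatibility with absolute values the claim (convergence, or f_∞ in S(N)) can fail. *)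

(* Defs.v *)
From HB Require Import structures.
From mathcomp Require Import all_boot all_order all_algebra.
From mathcomp Require Import all_classical all_reals all_analysis.

Set Implicit Arguments.
Unset Strict Implicit.
Unset Printing Implicit Defensive.

Import Order.TTheory GRing.Theory Num.Theory.
Import numFieldNormedType.Exports.

Local Open Scope classical_set_scope.
Local Open Scope ring_scope.

(** [R^n] is [n.-tuple R], with the product of the Borel sigma-algebras. *)

Section lebesgue_tuple.
Context {R : realType}.
Local Open Scope ereal_scope.

Definition tcons n (p : (R * n.-tuple R)%type) : n.+1.-tuple R :=
  [the n.+1.-tuple R of p.1 :: p.2].

Lemma measurable_tcons n : measurable_fun [set: (R * n.-tuple R)%type] (@tcons n).
Proof.
exact: (@measurable_cons _ _ (R * n.-tuple R)%type R fst n snd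
  measurable_fst measurable_snd).
Qed.

(** Lebesgue measure on [R^n], as an iterated product of [lebesgue_measure]. *)
Fixpoint lebesgue_tuple n : set (n.-tuple R) -> \bar R :=
  match n with
  | 0 => \d_ ([tuple] : 0.-tuple R)
  | n'.+1 => pushforward (@lebesgue_measure R \x @lebesgue_tuple n') (@tcons n')
  end.

Let lebesgue_tuple_sfm n :
  exists m : {sigma_finite_measure set (n.-tuple R) -> \bar R},
    (m : set _ -> \bar R) = @lebesgue_tuple n.
Proof.
elim: n => [|n [m mE]].
  by exists (\d_ ([tuple] : 0.-tuple R)).
pose p : {measure set (measurableTypeR R * n.-tuple R)%type -> \bar R} :=
  (@lebesgue_measure R \x m).
pose q0 : {measure set (n.+1.-tuple R) -> \bar R} :=
  measure_function_pushforward__canonical__measure_function_Measure p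
    (@measurable_tcons n).
have sq : sigma_finite setT (q0 : set (n.+1.-tuple R) -> \bar R).
  have /sigma_finiteP[F [TF ndF Foo]] := sigma_finiteT (@lebesgue_measure R).
  have /sigma_finiteP[G [TG ndG Goo]] := sigma_finiteT m.
  exists (fun i => (fun t : n.+1.-tuple R => (thead t, [tuple of behead t]))
                     @^-1` (F i `*` G i)).
    rewrite -preimage_bigcup; apply/seteqP; split => // t _ /=.
    have : [set: R] (thead t) by [].
    have : [set: n.-tuple R] [tuple of behead t] by [].
    rewrite TG TF => -[j _ Gj] [i _ Fi]; exists (maxn i j) => //; split => /=.
    - by apply: (subsetPset _ _ (ndF _ _ (leq_maxl i j))).
    - by apply: (subsetPset _ _ (ndG _ _ (leq_maxr i j))).
  move=> i; have [mF Fi] := Foo i; have [mG Gi] := Goo i; split.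
    rewrite -[X in measurable X]setTI.
    have mf : measurable_fun [set: n.+1.-tuple R]
        (fun t : n.+1.-tuple R => (thead t, [tuple of behead t])).
      by apply: measurable_fun_pair; [exact: measurable_tnth|exact: measurable_behead].
    by apply: mf => //; exact: measurableX.
  rewrite /q0 /= /pushforward -comp_preimage.
  rewrite (_ : _ \o _ = id) ?preimage_id//; last first.
    by apply/funext => -[x t]; rewrite /= /thead/=; congr pair; exact/val_inj.
  by rewrite product_measure1E// lte_mul_pinfty// ge0_fin_numE.
pose sfq := Measure_isSigmaFinite.Build _ _ _ q0 sq.
pose q : {sigma_finite_measure set (n.+1.-tuple R) -> \bar R} :=
  HB.pack (q0 : set (n.+1.-tuple R) -> \bar R) (Measure.class q0) sfq.
by exists q; rewrite /q /q0 /p /= mE.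
Qed.

Let lebesgue_tuple0 n : @lebesgue_tuple n set0 = 0.
Proof. by have [m <-] := lebesgue_tuple_sfm n; exact: measure0. Qed.

Let lebesgue_tuple_ge0 n A : 0 <= @lebesgue_tuple n A.
Proof. by have [m <-] := lebesgue_tuple_sfm n; exact: measure_ge0. Qed.

Let lebesgue_tuple_semi_sigma_additive n :
  semi_sigma_additive (@lebesgue_tuple n).
Proof.
by have [m <-] := lebesgue_tuple_sfm n; exact: measure_semi_sigma_additive.
Qed.

HB.instance Definition _ n := isMeasure.Build _ _ _ (@lebesgue_tuple n)
  (@lebesgue_tuple0 n) (@lebesgue_tuple_ge0 n)
  (@lebesgue_tuple_semi_sigma_additive n).

Let sigma_finite_lebesgue_tuple n : sigma_finite setT (@lebesgue_tuple n).
Proof. by have [m <-] := lebesgue_tuple_sfm n; exact: sigma_finiteT. Qed.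

HB.instance Definition _ n := Measure_isSigmaFinite.Build _ _ _
  (@lebesgue_tuple n) (@sigma_finite_lebesgue_tuple n).

Lemma lebesgue_tuple_box n (A : 'I_n -> set R) :
  (forall i, measurable (A i)) ->
  @lebesgue_tuple n [set t | forall i, A i (tnth t i)] =
  \prod_(i < n) @lebesgue_measure R (A i).
Proof.
elim: n A => [|n IH] A mA.
  rewrite big_ord0 /= diracE (_ : _ \in _) //.
  by apply/mem_set => -[].
rewrite big_ord_recl -IH//= /pushforward.
have mB : measurable [set t : n.-tuple R | forall i, A (lift ord0 i) (tnth t i)].
  rewrite (_ : [set t : n.-tuple R | _] = \bigcap_(i in [set: 'I_n])
      ((fun t => tnth t i) @^-1` A (lift ord0 i))); last first.
    by apply/seteqP; split => t /= h i; [move=> _|]; apply: h.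
  apply: fin_bigcap_measurable => // i _; rewrite -[X in measurable X]setTI.
  exact: measurable_tnth.
rewrite -(product_measure1E _ (@lebesgue_tuple n))//.
rewrite (_ : _ @^-1` _ = A ord0 `*`
    [set t : n.-tuple R | forall i, A (lift ord0 i) (tnth t i)]) //.
apply/seteqP; split => [[x t] h|[x t] [/= h0 h] i].
  split => /=; first exact: (h ord0).
  by move=> i; have := h (lift ord0 i); rewrite /tcons/= tnthS.
have [j ->|->] := unliftP ord0 i; last exact: h0.
by rewrite /tcons/= tnthS.
exact: mA.
Qed.

End lebesgue_tuple.

(** Functions of [(x, xi)] are considered up to [lebesgue_phase]-almost
    everywhere equality throughout. *)
Definition phase (R : realType) n : Type := (n.-tuple R * n.-tuple R)%type.

Definition lebesgue_phase {R : realType} n : set (phase R n) -> \bar R :=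
  (@lebesgue_tuple R n \x @lebesgue_tuple R n)%E.

HB.instance Definition _ (R : realType) n := Measure.on (@lebesgue_phase R n).

(** A function [f z t] of [z = (x, xi)] and [t]; only its values at times
    [t >= 0] are meaningful. *)
Definition state (R : realType) n : Type := phase R n -> R -> R.

Section kinetic.
Context {R : realType} {n : nat}.
Local Notation phase := (phase R n).
Local Notation state := (state R n).
Local Notation leb := (@lebesgue_tuple R n).
Local Notation lebz := (@lebesgue_phase R n).
Local Notation time := (@lebesgue_measure R).

(** The square of the Euclidean norm. *)
Definition sqnorm (xi : n.-tuple R) : R := \sum_(i < n) tnth xi i ^+ 2.

(** [(x, xi)] is sent to [(x + t xi, xi)]. *)
Definition flow (t : R) (z : phase) : phase :=
  ([tuple tnth z.1 i + t * tnth z.2 i | i < n], z.2).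

Definition along (f : state) (t : R) : phase -> R := fun z => f (flow t z) t.

(** [I(f, x, xi, t)] is only defined for some [f] and [t]; [interact] is a total
    function whose values are meaningful where [well_defined] holds. *)
Record interaction := Interaction {
  well_defined : state -> R -> Prop ;
  interact :> state -> phase -> R -> R }.

Definition free : interaction :=
  @Interaction (fun _ _ => True) (fun _ _ _ => 0).

(** Each of the three conditions contains the convergence of its integral. *)
Definition mesoscopic (I : interaction) : Prop :=
  forall (f : state) (t : R), 0 <= t -> well_defined I f t ->
  {ae leb, forall x,
    [/\ leb.-integrable setT (fun xi => (I f (x, xi) t)%:E) /\
        (\int[leb]_xi (I f (x, xi) t)%:E = 0)%E,
        leb.-integrable setT (fun xi => (I f (x, xi) t * sqnorm xi)%:E) /\
        (\int[leb]_xi (I f (x, xi) t * sqnorm xi)%:E = 0)%E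
      & forall i : 'I_n,
        leb.-integrable setT (fun xi => (I f (x, xi) t * tnth xi i)%:E) /\
        (\int[leb]_xi (I f (x, xi) t * tnth xi i)%:E = 0)%E]}.

(** A norm on the measurable functions of [(x, xi)] with finite norm, extended
    by [+oo]; its values on non-measurable functions are irrelevant.
    [onorm_solid] is the compatibility with absolute values which gives
    [onorm (\int g_t dt) <= onorm (\int `|g_t| dt)]; it also makes [onorm]
    invariant under almost everywhere equality. *)
Record observers_norm (I : interaction) := ObserversNorm {
  onorm :> (phase -> R) -> \bar R ;
  onorm_ge0 : forall g : phase -> R, measurable_fun setT g -> (0 <= onorm g)%E ;
  onormZ : forall (a : R) (g : phase -> R), measurable_fun setT g ->
    onorm (fun z => (a * g z)%R) = (`|a|%:E * onorm g)%E ;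
  onormD : forall g h : phase -> R, measurable_fun setT g -> measurable_fun setT h ->
    (onorm (fun z => (g z + h z)%R) <= onorm g + onorm h)%E ;
  onorm_eq0 : forall g : phase -> R, measurable_fun setT g -> onorm g = 0%E ->
    {ae lebz, forall z, g z = 0} ;
  onorm_solid : forall g h : phase -> R, measurable_fun setT g -> measurable_fun setT h ->
    {ae lebz, forall z, `|g z| <= h z} -> (onorm g <= onorm h)%E ;
  onorm_well_defined : forall (f : state) (t : R), 0 <= t ->
    measurable_fun setT (f ^~ t) -> (onorm (f ^~ t) < +oo)%E ->
    well_defined I f t ;
  onorm_moments : forall g : phase -> R, measurable_fun setT g -> (onorm g < +oo)%E ->
    [/\ lebz.-integrable setT (fun z => (g z)%:E),
        forall i : 'I_n, lebz.-integrable setT (fun z => (g z * tnth z.2 i)%:E)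
      & lebz.-integrable setT (fun z => (g z * sqnorm z.2)%:E)] }.

(** The norm of a function which may be infinite on a null set. *)
Definition onorm_ext (I : interaction) (nrm : observers_norm I)
    (g : phase -> \bar R) : \bar R :=
  if `[< {ae lebz, forall z, g z \is a fin_num} >]
  then nrm (fun z => fine (g z)) else +oo%E.

(** [f] solves the kinetic equation with interaction [I] and initial datum [f0],
    along almost every characteristic. *)
Definition mild_solution (I : interaction) (f0 : phase -> R) (f : state) : Prop :=
  [/\ measurable_fun [set zt : phase * R | 0 <= zt.2] (fun zt => f zt.1 zt.2),
      (forall t, 0 <= t -> well_defined I f t) /\
      measurable_fun [set zt : phase * R | 0 <= zt.2] (fun zt => I f zt.1 zt.2),
      forall z, f z 0 = f0 z
    & {ae lebz, forall z, forall t, 0 <= t ->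
        time.-integrable `[0, t] (fun s => (I f (flow s z) s)%:E) /\
        f (flow t z) t = f0 z + \int[time]_(s in `[0, t]) I f (flow s z) s}].

Definition scattered (I : interaction) (f : state) (a : R) : phase -> \bar R :=
  fun z => (\int[time]_(t in `[a, +oo[) `|I f (flow t z) t|%:E)%E.

Definition uniform_scattering_solution (I : interaction)
    (nrm : observers_norm I) (f0 : phase -> R) (f : state) : Prop :=
  [/\ mild_solution I f0 f,
      (nrm (f ^~ 0%R) + onorm_ext nrm (scattered I f 0%R) < +oo)%E
    & onorm_ext nrm (scattered I f a) @[a --> +oo] --> 0%E].

Section scattering_space.
Context (I : interaction) (nrm : observers_norm I).

Definition scattering_norm (f : state) : \bar R :=
  ereal_sup [set nrm (along f t) | t in [set t : R | 0 <= t]].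

Definition scattering_space (C : R) : set state :=
  [set f | (forall t, 0 <= t -> measurable_fun setT (f ^~ t)) /\
           (scattering_norm f <= C%:E)%E].

(** The elements of the completion of [scattering_space C] are represented by
    the Cauchy sequences of [scattering_space C]; two of them represent the same
    element when the norm of their difference tends to [0]. *)
Definition scattering_completion (C : R) : set (nat -> state) :=
  [set G | (forall k, scattering_space C (G k)) /\
    forall e : R, 0 < e -> \forall k \near \oo, forall i j,
      (k <= i)%N -> (k <= j)%N ->
      (scattering_norm (fun z t => G i z t - G j z t)%R <= e%:E)%E].

(** [finf] is in [scattering_space C], solves the linear transport equation, and
    its initial value is the limit of [f] along characteristics. *)
Definition scattering_limit (C : R) (f finf : state) : Prop :=
  [/\ scattering_space C finf,
      mild_solution free (finf ^~ 0) finf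
    & nrm (fun z => along f t z - finf z 0) @[t --> +oo] --> 0%E].

(** The same for an element of the completion: the transport equation reads
    [G (x + t xi, xi, t) = G (x, xi, 0)] for [t >= 0], and the norm of a Cauchy
    sequence is the limit of the norms of its terms. *)
Definition completed_scattering_limit (C : R) (f : state) (G : nat -> state) :
    Prop :=
  [/\ scattering_completion C G,
      forall t, 0 <= t -> nrm (fun z => along (G k) t z - G k z 0) @[k --> \oo]
                          --> 0%E
    & limn (fun k => nrm (fun z => along f t z - G k z 0)) @[t --> +oo]
      --> 0%E].

End scattering_space.

End kinetic.

Arguments interaction : clear implicits.
Arguments mesoscopic {R n}.

(* Main.v *)
(** Along almost every characteristic the tail of the interaction is absolutely
    integrable, so [f (x + t xi, xi, t)] converges to
    [g = f0 + \int_0^oo I (x + s xi, xi, s) ds], and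
    [`|f (x + t xi, xi, t) - g|] is at most [\int_t^oo `|I|]. Solidity of the norm
    turns this pointwise bound into convergence of the norms, and at [t = 0] into
    the bound of the norm of [g] by [N]. The solution is the free transport of
    [g], which is constant along characteristics; uniqueness reduces to initial
    values by the triangle inequality. *)
Require Import Defs.
From mathcomp Require Import all_boot all_order all_algebra.
From mathcomp Require Import all_classical all_reals all_analysis.
From mathcomp Require Import measurable_realfun.
From mathcomp Require Import ring.

Set Implicit Arguments.
Unset Strict Implicit.
Unset Printing Implicit Defensive.

Import Order.TTheory GRing.Theory Num.Theory.
Import numFieldNormedType.Exports.

Local Open Scope classical_set_scope.
Local Open Scope ring_scope.

(** * Auxiliary facts: parametrized integrals, and limits to zero in the extended reals *)

(** The extension of [F] by zero is split into positive and negative parts; Tonelli makes each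
    integral measurable in [x], whether or not the sections of [F] are integrable. *)
Lemma measurable_fun_integral_section d1 d2 (T1 : measurableType d1)
    (T2 : measurableType d2) (R : realType)
    (mu : {sigma_finite_measure set T2 -> \bar R}) (D : set T2)
    (F : T1 * T2 -> \bar R) :
  measurable D -> measurable_fun ([set: T1] `*` D) F ->
  measurable_fun setT (fun x => \int[mu]_(y in D) F (x, y))%E.
Proof.
move=> mD mF; pose G := F \_ ([set: T1] `*` D).
have mG : measurable_fun setT G.
  by apply/(measurable_restrictT F _) => //; exact: measurableX.
rewrite (_ : (fun x => _) = fun x =>
    (\int[mu]_y G^\+ (x, y) - \int[mu]_y G^\- (x, y))%E); last first.
  apply/funext => x; rewrite integral_mkcond integralE.
  congr (_ - _)%E; apply: eq_integral => y _;
  by rewrite ?(funeposE, funenegE) /G /patch in_setX in_setT.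
apply: emeasurable_funB; apply: (@measurable_fun_fubini_tonelli_F _ _ _ _ _ mu).
- exact: measurable_funepos.
- by move=> x; exact: funepos_ge0.
- exact: measurable_funeneg.
- by move=> x; exact: funeneg_ge0.
Qed.

(** Convergence to a finite limit in [\bar R] means eventual finiteness plus convergence of the real
    parts; for nonnegative values the single upper bound supplies both. *)
Lemma cvge0_nearP (R : realType) (T : Type) (F : set_system T) {FF : Filter F}
    (u : T -> \bar R) :
  (\forall x \near F, 0 <= u x)%E ->
  u @ F --> 0%E <-> forall e : R, 0 < e -> \forall x \near F, (u x <= e%:E)%E.
Proof.
move=> u0; split => [/fine_cvgP[ufin /cvgr0Pnorm_le uF] e e0|ule].
  near=> x; rewrite -[u x]fineK; last by near: x.
  rewrite lee_fin (le_trans (ler_norm _))//.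
  by near: x; exact: uF.
have ufin : \forall x \near F, u x \is a fin_num.
  near=> x; rewrite ge0_fin_numE; last by near: x.
  by apply: le_lt_trans (ltry 1); near: x; exact: ule.
apply/fine_cvgP; split => //; apply/cvgr0Pnorm_le => e e0.
near=> x; rewrite /= ger0_norm; last by apply: fine_ge0; near: x.
rewrite -lee_fin fineK; last by near: x.
by near: x; exact: ule.
Unshelve. all: by end_near. Qed.

(** * The free flow and measurability along it at nonnegative times *)

Section flow.
Context {R : realType} {n : nat}.
Local Notation phase := (phase R n).

Lemma flowD (s t : R) (z : phase) : flow t (flow s z) = flow (s + t) z.
Proof.
rewrite /flow /=; congr pair; apply: eq_from_tnth => i.
by rewrite !tnth_mktuple mulrDl addrA.
Qed.

Lemma flow0 (z : phase) : flow 0 z = z.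
Proof.
case: z => x xi; rewrite /flow /=; congr pair; apply: eq_from_tnth => i.
by rewrite tnth_mktuple mul0r addr0.
Qed.

Lemma measurable_flow :
  measurable_fun setT (fun zt : phase * R => flow zt.2 zt.1).
Proof.
apply: measurable_fun_pair; last exact: measurableT_comp measurable_snd measurable_fst.
apply/measurable_fun_tnthP => i.
rewrite (_ : _ \o _ = fun zt : phase * R =>
    tnth zt.1.1 i + zt.2 * tnth zt.1.2 i); last first.
  by apply/funext => zt /=; rewrite tnth_mktuple.
apply: measurable_funD.
  apply: (measurableT_comp (measurable_tnth i)).
  exact: measurableT_comp measurable_fst measurable_fst.
apply: measurable_funM; first exact: measurable_snd.
apply: (measurableT_comp (measurable_tnth i)).
exact: measurableT_comp measurable_snd measurable_fst.
Qed.

Lemma measurable_flow_at (t : R) : measurable_fun setT (@flow R n t).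
Proof.
exact: (measurableT_comp measurable_flow (pair2_measurable t)).
Qed.

Lemma measurable_future :
  measurable [set zt : phase * R | 0 <= zt.2].
Proof.
rewrite (_ : [set _ | _] = setT `*` `[0, +oo[ ); last first.
  by apply/seteqP; split => -[z t] /=; rewrite in_itv /= andbT; [|case].
exact: measurableX.
Qed.

Lemma measurable_future_flow (F : phase * R -> R) :
  measurable_fun [set zt : phase * R | 0 <= zt.2] F ->
  measurable_fun [set zt : phase * R | 0 <= zt.2]
    (fun zt => F (flow zt.2 zt.1, zt.2)).
Proof.
move=> mF; apply: (measurable_comp measurable_future _ mF).
  by move=> _ [zt zt0 <-].
apply: measurable_funTS; apply: measurable_fun_pair => //.
exact: measurable_flow.
Qed.

Lemma measurable_future_at (F : phase * R -> R) (t : R) : 0 <= t ->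
  measurable_fun [set zt : phase * R | 0 <= zt.2] F ->
  measurable_fun setT (fun z => F (z, t)).
Proof.
move=> t0 mF; apply: (measurable_comp measurable_future _ mF).
  by move=> _ [z _ <-].
exact: pair2_measurable.
Qed.

Lemma measurable_future_section (F : phase * R -> R) (z : phase) (D : set R) :
  D `<=` `[0, +oo[ -> measurable D ->
  measurable_fun [set zt : phase * R | 0 <= zt.2] F ->
  measurable_fun D (fun t => F (z, t)).
Proof.
move=> D0 mD mF; apply: (measurable_comp measurable_future _ mF).
  by move=> _ [t /D0/= + <-]; rewrite in_itv/= andbT.
by apply: measurable_funTS; exact: pair1_measurable.
Qed.

End flow.

(** * Consequences of the axioms of an observer's norm *)

Section norm.
Context {R : realType} {n : nat} {I : interaction R n} (nrm : observers_norm I).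
Implicit Types g h k : phase R n -> R.

Lemma onormN g : measurable_fun setT g -> nrm (fun z => - g z) = nrm g.
Proof.
move=> mg; have := onormZ nrm (-1) mg; rewrite normrN1 mul1e => <-.
by congr (nrm _); apply/funext => z; rewrite mulN1r.
Qed.

Lemma onorm_distC g h : measurable_fun setT g -> measurable_fun setT h ->
  nrm (fun z => g z - h z) = nrm (fun z => h z - g z).
Proof.
move=> mg mh; rewrite -[RHS]onormN; last exact: measurable_funB.
by congr (nrm _); apply/funext => z; rewrite opprB.
Qed.

Lemma onorm_triangle h g k : measurable_fun setT g -> measurable_fun setT h ->
  measurable_fun setT k ->
  (nrm (fun z => g z - k z)%R
    <= nrm (fun z => g z - h z)%R + nrm (fun z => h z - k z)%R)%E.
Proof.
move=> mg mh mk; rewrite (_ : (fun z => g z - k z) =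
    fun z => (g z - h z) + (h z - k z)); last first.
  by apply/funext => z; rewrite addrA subrK.
by apply: onormD; exact: measurable_funB.
Qed.

Lemma onormB_le g h : measurable_fun setT g -> measurable_fun setT h ->
  (nrm (fun z => g z - h z)%R <= nrm g + nrm h)%E.
Proof.
move=> mg mh; rewrite -(onormN mh).
by apply: onormD => //; exact: measurableT_comp.
Qed.

Lemma onorm_along_le_scattering_norm (u : state R n) (t : R) : 0 <= t ->
  (nrm (along u t) <= scattering_norm nrm u)%E.
Proof. by move=> t0; apply: ereal_sup_ubound; exists t. Qed.

End norm.

(** * Solutions of the linear transport equation *)

Section free_transport.
Context {R : realType} {n : nat}.

Definition free_transport (g : phase R n -> R) : state R n :=
  fun z t => g (flow (- t) z).

Lemma along_free_transport g t : along (free_transport g) t = g.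
Proof. by apply/funext => z; rewrite /along /free_transport flowD subrr flow0. Qed.

Lemma free_transport0 g : (free_transport g) ^~ 0 = g.
Proof. by apply/funext => z; rewrite /free_transport oppr0 flow0. Qed.

Lemma mild_solution_free_transport g : measurable_fun setT g ->
  mild_solution (@Defs.free R n) ((free_transport g) ^~ 0) (free_transport g).
Proof.
move=> mg; split => //.
- apply: measurable_funTS; apply: (measurableT_comp mg).
  apply: (measurableT_comp measurable_flow
    (g := fun zt : phase R n * R => (zt.1, - zt.2))).
  by apply: measurable_fun_pair => //; exact: measurableT_comp.
- apply: aeW => z t t0; split; first exact: integrable0.
  rewrite /Rintegral integral0 addr0 -/(along (free_transport g) t z).
  by rewrite along_free_transport -[in LHS](free_transport0 g).
Qed.

(** The integrand in the mild equation is zero, which leaves constancy along characteristics; the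
    exceptional null set does not depend on [t]. *)
Lemma mild_solution_free_along g0 (g : state R n) :
  mild_solution (@Defs.free R n) g0 g ->
  {ae @lebesgue_phase R n, forall z, forall t, 0 <= t -> along g t z = g0 z}.
Proof.
case=> _ _ _; apply: filterS => z gz t /gz[_].
by rewrite /along => ->; rewrite /Rintegral integral0 addr0.
Qed.

End free_transport.

(** * The asymptotic datum and its distance to the solution *)

Section scattering_datum.
Context {R : realType} {n : nat} {I : interaction R n}.
Variables (f0 : phase R n -> R) (f : state R n).
Hypothesis hf : mild_solution I f0 f.

Let measurable_interaction_flow : measurable_fun
  [set zt : phase R n * R | 0 <= zt.2] (fun zt => I f (flow zt.2 zt.1) zt.2).
Proof.
by case: hf => _ [_ mI] _ _; exact: (measurable_future_flow mI).
Qed.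

Lemma measurable_along t : 0 <= t -> measurable_fun setT (along f t).
Proof.
case: hf => mf _ _ _ t0.
exact: (measurable_future_at t0 (measurable_future_flow mf)).
Qed.

Lemma measurable_datum : measurable_fun setT f0.
Proof.
case: hf => mf _ f0E _; rewrite (_ : f0 = f ^~ 0); last exact/funext.
exact: (measurable_future_at (lexx 0) mf).
Qed.

Lemma along0 : along f 0 = f0.
Proof. by case: hf => _ _ f0E _; apply/funext => z; rewrite /along flow0 f0E. Qed.

Let subset_future (a : R) : 0 <= a ->
  setT `*` `[a, +oo[ `<=` [set zt : phase R n * R | 0 <= zt.2].
Proof.
move=> a0 [z t] [_] /=; rewrite in_itv/= andbT; exact: le_trans.
Qed.

Lemma measurable_scattered a : 0 <= a ->
  measurable_fun setT (scattered I f a).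
Proof.
move=> a0; apply: (@measurable_fun_integral_section _ _ _ _ _
  (@lebesgue_measure R) `[a, +oo[%classic
  (fun zt => `|I f (flow zt.2 zt.1) zt.2|%:E)) => //.
apply/measurable_EFinP; apply: measurableT_comp => //.
exact: measurable_funS measurable_future (subset_future a0) _.
Qed.

(** The real integral is [fine] of the extended one, so the function is total; it is compared with
    [f] only at those [z] where [scattered I f 0 z] is finite. *)
Definition scattering_datum (z : phase R n) : R :=
  f0 z + \int[@lebesgue_measure R]_(t in `[0, +oo[) I f (flow t z) t.

Lemma measurable_scattering_datum : measurable_fun setT scattering_datum.
Proof.
apply: measurable_funD; first exact: measurable_datum.
apply: (measurableT_comp (fine_measurable measurableT)).
apply: (@measurable_fun_integral_section _ _ _ _ _
  (@lebesgue_measure R) `[0, +oo[%classic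
  (fun zt => (I f (flow zt.2 zt.1) zt.2)%:E)) => //.
apply/measurable_EFinP.
exact: measurable_funS measurable_future (subset_future (lexx 0)) _.
Qed.

Let measurable_interaction_along z (D : set R) : D `<=` `[0, +oo[ ->
  measurable D ->
  measurable_fun D (fun t => I f (flow t z) t).
Proof.
move=> D0 mD.
exact: (measurable_future_section z D0 mD measurable_interaction_flow).
Qed.

Lemma scattered_le a b z : 0 <= a -> a <= b ->
  (scattered I f b z <= scattered I f a z)%E.
Proof.
move=> a0 ab; apply: ge0_subset_integral => //.
  apply/measurable_EFinP; apply: measurableT_comp => //.
  apply: measurable_interaction_along => //.
  by apply: subset_itvr; rewrite bnd_simp.
by apply: subset_itvr; rewrite bnd_simp.
Qed.

(** Finiteness of [scattered I f 0 z] makes the interaction integrable on the half-line, so the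
    integral in the datum can be cut at [t]. The mild equation cancels [f0 z] and the part over
    [[0, t]], leaving minus the tail. *)
Lemma along_scattering_datum_le :
  {ae @lebesgue_phase R n, forall z, scattered I f 0 z \is a fin_num ->
    forall t, 0 <= t ->
    `|along f t z - scattering_datum z| <= fine (scattered I f t z)}.
Proof.
case: hf => _ _ _; apply: filterS => z fz sfin t t0.
have sub : [set` `]t, +oo[] `<=` [set` `[0, +oo[].
  by apply: subset_itvr; rewrite bnd_simp.
have intJ : (@lebesgue_measure R).-integrable `[0, +oo[
    (fun s => (I f (flow s z) s)%:E).
  apply/integrableP; split.
    by apply/measurable_EFinP; exact: measurable_interaction_along.
  by rewrite ltey_eq; apply/orP; left.
have stfin : scattered I f t z \is a fin_num.
  rewrite ge0_fin_numE ?integral_ge0//.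
  by apply: le_lt_trans (scattered_le z (lexx 0) t0) _; rewrite ltey_eq sfin.
rewrite /along /scattering_datum; have [_ ->] := fz t t0.
have -> : [set` `[0, +oo[] = [set` `[0, t]] `|` [set` `]t, +oo[] :> set R.
  by rewrite -itv_bndbnd_setU// bnd_simp.
rewrite Rintegral_setU//; last 2 first.
- by rewrite -itv_bndbnd_setU// bnd_simp.
- apply/disj_setPS => x [] /=; rewrite !in_itv/= andbT => /andP[_ xt].
  by rewrite ltNge xt.
rewrite opprD addrACA subrr add0r opprD addrA subrr sub0r normrN.
have intt : (@lebesgue_measure R).-integrable `]t, +oo[
    (fun s => (I f (flow s z) s)%:E) by exact: integrableS intJ.
apply: le_trans (le_normr_Rintegral _ intt) _ => //.
rewrite fine_le//.
  apply: integrable_fin_num => //; exact: integrable_abse intt.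
(* The cut leaves the tail over []t, +oo[], whereas [scattered] integrates over [[t, +oo[]. *)
apply: ge0_subset_integral => //.
- apply/measurable_EFinP; apply: measurableT_comp => //.
  apply: measurable_interaction_along => //.
  by apply: subset_itvr; rewrite bnd_simp.
- by apply: subset_itvr; rewrite bnd_simp.
Qed.

Variable nrm : observers_norm I.

Lemma onorm_along_scattering_datum_le t : 0 <= t ->
  (onorm_ext nrm (scattered I f 0) < +oo)%E ->
  (nrm (fun z => along f t z - scattering_datum z)%R
    <= onorm_ext nrm (scattered I f t))%E.
Proof.
(* [onorm_ext] is [+oo] unless its argument is finite almost everywhere, so the hypothesis yields
   this finiteness for [scattered I f 0]. *)
rewrite /onorm_ext; case: asboolP => // fin0 t0 _.
case: asboolP => [fint|_]; last exact: leey.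
apply: onorm_solid.
- apply: measurable_funB; [exact: measurable_along|exact: measurable_scattering_datum].
- apply: (measurableT_comp (fine_measurable measurableT)).
  exact: measurable_scattered.
- by apply: filterS2 fin0 along_scattering_datum_le => z + le; move=> /le; exact.
Qed.

End scattering_datum.

(** * Existence and uniqueness of the scattering limit, also in the completion *)

(** Exchanging [i] and [j] in the one-sided bound shows that the real parts form a Cauchy sequence.
    This serves to show that a [limn] is a genuine limit. *)
Lemma cvgn_ereal_cauchy (R : realType) (u : nat -> \bar R) :
  (forall k, u k \is a fin_num) ->
  (forall e : R, 0 < e -> \forall k \near \oo, forall i j,
    (k <= i)%N -> (k <= j)%N -> (u i <= u j + e%:E)%E) ->
  cvgn u.
Proof.
move=> ufin uC.
suff /cvg_ex[l ul] : cvgn (fine \o u).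
  by apply: (@cvgP _ _ l%:E); apply/fine_cvgP; split => //; exact: nearW.
apply/cauchy_cvgP/cauchy_exP => e e0.
(* Balls are defined by a strict inequality and the hypothesis gives a weak one, hence [e / 2]. *)
have [k kC] : exists k, forall i j, (k <= i)%N -> (k <= j)%N ->
    (u i <= u j + (e / 2)%:E)%E.
  by apply: (@filter_ex _ \oo); apply: uC; rewrite divr_gt0.
exists (fine (u k)); exists k => // i /= ki.
rewrite /ball/= (@le_lt_trans _ _ (e / 2))//; last first.
  by rewrite ltr_pdivrMr// ltr_pMr// ltr1n.
rewrite ler_distlC lerBlDr -!lee_fin !EFinD !fineK//.
by apply/andP; split; apply: kC.
Qed.

Section scattering.
Context {R : realType} {n : nat} {I : interaction R n} (nrm : observers_norm I).
Variables (f0 : phase R n -> R) (f : state R n) (N : R).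
Hypothesis hf : uniform_scattering_solution nrm f0 f.
Hypothesis hN : N%:E = (nrm (f ^~ 0%R) + onorm_ext nrm (scattered I f 0%R))%E.
Local Notation g := (scattering_datum (I := I) f0 f).

Let mild : mild_solution I f0 f. Proof. by case: hf. Qed.
Let mg : measurable_fun setT g. Proof. exact: measurable_scattering_datum. Qed.
Let mf0 : measurable_fun setT f0. Proof. exact: measurable_datum mild. Qed.
Let f_0 : f ^~ 0 = f0.
Proof. by case: mild => _ _ f0E _; apply/funext. Qed.

Let scattered_finite : (onorm_ext nrm (scattered I f 0) < +oo)%E.
Proof.
case: hf => _ + _; rewrite f_0; apply: le_lt_trans.
by rewrite leeDr// onorm_ge0.
Qed.

(** Since [g = f0 - (f0 - g)] and [f0] is [along f 0], the tail estimate at [t = 0] bounds the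
    second term by the second summand of [N]. *)
Let onorm_datum_le : (nrm g <= N%:E)%E.
Proof.
rewrite hN f_0 (_ : nrm g = nrm (fun z => f0 z - (f0 z - g z))); last first.
  by congr (nrm _); apply/funext => z; rewrite subKr.
apply: le_trans (onormB_le nrm mf0 (measurable_funB mf0 mg)) _.
rewrite leeD2l// -{1}(along0 mild).
exact: onorm_along_scattering_datum_le.
Qed.

Lemma along_cvg_scattering_datum :
  nrm (fun z => along f t z - g z) @[t --> +oo] --> 0%E.
Proof.
have [_ _ sc] := hf.
apply: (@squeeze_cvge _ _ _ _ (cst 0%E) _ _ _ _ (@cvg_cst _ _ _ _ _) sc).
near=> t; have t0 : 0 <= t by near: t; exact: nbhs_pinfty_ge.
rewrite onorm_ge0/= ?onorm_along_scattering_datum_le//.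
by apply: measurable_funB => //; exact: measurable_along mild _ t0.
Unshelve. all: by end_near. Qed.

Lemma scattering_limit_free_transport :
  scattering_limit nrm N f (free_transport g).
Proof.
split.
- split => [t _|].
    exact: measurableT_comp mg (measurable_flow_at _).
  (* Free transport is constant along characteristics, so every norm in the supremum is that of
     [g]. *)
  apply: ge_ereal_sup => _ [t _ <-]; rewrite along_free_transport.
  exact: onorm_datum_le.
- exact: mild_solution_free_transport.
- rewrite (_ : (fun t => _) = fun t => nrm (fun z => along f t z - g z)).
    exact: along_cvg_scattering_datum.
  by rewrite -[in RHS](free_transport0 g).
Qed.

Let onorm_datum_sub_le (h : phase R n -> R) (t : R) : 0 <= t ->
  measurable_fun setT h ->
  (nrm (fun z => h z - g z)%R <= nrm (fun z => along f t z - h z)%R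
    + nrm (fun z => along f t z - g z)%R)%E.
Proof.
move=> t0 mh; have mft := measurable_along mild t0.
by rewrite (onorm_distC nrm mft mh) onorm_triangle.
Qed.

(** The distance from [h] at time 0 to [g] does not depend on [t], yet it is bounded by two
    distances to [along f t] that both tend to zero. The initial values thus agree almost
    everywhere, and constancy along characteristics extends this to all [t]. *)
Lemma scattering_limit_unique (h : state R n) : scattering_limit nrm N f h ->
  {ae @lebesgue_phase R n, forall z, forall t, 0 <= t ->
    along h t z = along (free_transport g) t z}.
Proof.
case=> -[mh _] mildh hlim; have mh0 := mh 0 (lexx 0).
have mB : measurable_fun setT (fun z => h z 0 - g z) by exact: measurable_funB.
have /(onorm_eq0 mB) : nrm (fun z => h z 0 - g z) = 0%E.
  apply/eqP; rewrite eq_le onorm_ge0// andbT.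
  (* The bound [0] becomes [0 + 0], the sum of the two limits. *)
  rewrite -[leRHS]adde0.
  apply: cvge_to_ge (cvgeD _ hlim along_cvg_scattering_datum) _ => //.
  near=> t; have t0 : 0 <= t by near: t; exact: nbhs_pinfty_ge.
  exact: onorm_datum_sub_le.
apply: filterS2 (mild_solution_free_along mildh) => z ht /eqP.
by rewrite subr_eq0 => /eqP hg t t0; rewrite along_free_transport -hg ht.
Unshelve. all: by end_near. Qed.

(** First, [G k] at time 0 tends to [g], by comparing both with [f] at one large time. The Cauchy
    property in the scattering norm, which is uniform in [t], then upgrades this to convergence in
    that norm. *)
Lemma completed_scattering_limit_unique (G : nat -> state R n) :
  completed_scattering_limit nrm N f G ->
  scattering_norm nrm (fun z t => G k z t - free_transport g z t)
    @[k --> \oo] --> 0%E.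
Proof.
case=> -[GS GC] Gfree Glim.
have mG k t : 0 <= t -> measurable_fun setT (along (G k) t).
  move=> t0; have [mGk _] := GS k.
  exact: measurableT_comp (mGk t t0) (measurable_flow_at t).
have G0 k : along (G k) 0 = G k ^~ 0.
  by apply/funext => z; rewrite /along flow0.
have mG0 k : measurable_fun setT (G k ^~ 0) by rewrite -G0; exact: mG.
have GB k t : along (fun z t => G k z t - free_transport g z t) t =
    fun z => along (G k) t z - g z.
  by apply/funext => z; rewrite -[in RHS](along_free_transport g t).
have mf t : 0 <= t -> measurable_fun setT (along f t).
  by move=> t0; exact: (measurable_along mild t0).
have onormG0 k : (nrm (G k ^~ 0%R) <= N%:E)%E.
  rewrite -G0; apply: le_trans (onorm_along_le_scattering_norm _ _ (lexx 0)) _.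
  by case: (GS k).
(* The constant [1] is an arbitrary finite bound: with the bound [N] on [g] and on [G k] at time 0,
   it makes every term of the sequence finite. *)
have cvgG t : 0 <= t -> (nrm (fun z => along f t z - g z)%R <= 1%:E)%E ->
    cvgn (fun k => nrm (fun z => along f t z - G k z 0)).
  move=> t0 ft1; apply: cvgn_ereal_cauchy => [k|e /GC].
    rewrite ge0_fin_numE; last by apply: onorm_ge0; apply: measurable_funB => //; exact: mf.
    apply: le_lt_trans (onorm_triangle nrm (mf _ t0) mg (mG0 k)) _.
    apply: (@le_lt_trans _ _ (1%:E + (N%:E + N%:E))%E); last by rewrite ltry.
    apply: leeD => //; apply: le_trans (onormB_le nrm mg (mG0 k)) _.
    exact: leeD.
  apply: filterS => k kC i j ki kj.
  apply: le_trans (onorm_triangle nrm (mf _ t0) (mG0 j) (mG0 i)) _.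
  rewrite leeD2l//; apply: le_trans (kC _ _ kj ki).
  rewrite (_ : (fun z => _) = along (fun z t => G j z t - G i z t) 0).
    exact: onorm_along_le_scattering_norm.
  by apply/funext => z; rewrite /along flow0.
have f_g : forall e : R, 0 < e -> \forall t \near +oo,
    (nrm (fun z => along f t z - g z)%R <= e%:E)%E.
  apply/cvge0_nearP; last exact: along_cvg_scattering_datum.
  near=> t; have t0 : 0 <= t by near: t; exact: nbhs_pinfty_ge.
  by apply: onorm_ge0; apply: measurable_funB => //; exact: mf.
have f_G : forall e : R, 0 < e -> \forall t \near +oo,
    (limn (fun k => nrm (fun z => along f t z - G k z 0)%R) <= e%:E)%E.
  apply/cvge0_nearP; last exact: Glim.
  near=> t; have t0 : 0 <= t by near: t; exact: nbhs_pinfty_ge.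
  (* Nonnegativity passes to [limn] once the sequence is known to converge, which [cvgG] gives for
     large [t]. *)
  apply: lime_ge; first by apply: cvgG => //; near: t; exact: f_g.
  apply: nearW => k.
  by apply: onorm_ge0; apply: measurable_funB => //; exact: mf.
have G_g (e : R) : 0 < e ->
    \forall k \near \oo, (nrm (fun z => G k z 0 - g z)%R <= e%:E)%E.
  move=> e0; have e2 : 0 < e / 2 by rewrite divr_gt0.
  have e4 : 0 < e / 2 / 2 by rewrite divr_gt0.
  (* One time [t] is fixed before [k]. The bound by [1] is the one [cvgG] asks for; the limit is
     made at most [e / 4] so that it lies strictly below [e / 2], an open condition that the terms
     inherit for large [k]. *)
  have [t [[t0 ft1] ft2 Gt]] : exists t, [/\ 0 <= t /\
      (nrm (fun z => along f t z - g z)%R <= 1%:E)%E,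
      (nrm (fun z => along f t z - g z)%R <= (e / 2)%:E)%E &
      (limn (fun k => nrm (fun z => along f t z - G k z 0)%R)
        <= (e / 2 / 2)%:E)%E].
    apply: (@filter_ex _ +oo%R); near=> t; split; [split| |]; near: t.
    - exact: nbhs_pinfty_ge.
    - exact: f_g.
    - exact: f_g.
    - exact: f_G.
  have lim_lt : (limn (fun k => nrm (fun z => along f t z - G k z 0)%R)
      < (e / 2)%:E)%E.
    by apply: le_lt_trans Gt _; rewrite lte_fin ltr_pdivrMr// ltr_pMr// ltr1n.
  have := cvgG t t0 ft1 _ (open_ereal_lt' lim_lt).
  apply: (@filterS _ \oo) => k /= /ltW Gk.
  rewrite [e]splitr EFinD.
  by apply: le_trans (onorm_datum_sub_le t0 (mG0 k)) _; exact: leeD.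
apply/cvge0_nearP => [|e e0].
  apply: nearW => k.
  apply: le_trans (onorm_along_le_scattering_norm _ _ (lexx 0)).
  rewrite GB; apply: onorm_ge0; apply: measurable_funB => //; exact: mG.
have e3 : 0 < e / 3 by rewrite divr_gt0.
apply: filterS (GC _ e3) => i iC.
apply: ge_ereal_sup => _ [t t0 <-]; rewrite GB.
(* The index [j] may depend on [t], because [Gfree] is convergence at each fixed time; [i] was
   chosen before [t], so the final bound holds for the supremum. The three thirds compare [G i] with
   [G j] at time [t], [G j] at time [t] with time 0, and [G j] at time 0 with [g]. *)
have [j [ij Gjt Gjg]] : exists j, [/\ (i <= j)%N,
    (nrm (fun z => along (G j) t z - G j z 0)%R <= (e / 3)%:E)%E &
    (nrm (fun z => G j z 0 - g z)%R <= (e / 3)%:E)%E].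
  apply: (@filter_ex _ \oo); near=> j; split; near: j.
  - exact: nbhs_infty_ge.
  - apply: ((cvge0_nearP _).1 (Gfree t t0) _ e3).
    by apply: nearW => k; apply: onorm_ge0; apply: measurable_funB => //; exact: mG.
  - exact: G_g.
have -> : e = e / 3 + (e / 3 + e / 3) by field.
rewrite !EFinD.
apply: le_trans (onorm_triangle nrm (mG i _ t0) (mG j _ t0) mg) _.
apply: leeD.
  apply: le_trans (iC _ _ (leqnn i) ij).
  exact: (onorm_along_le_scattering_norm nrm (fun z t => G i z t - G j z t)).
apply: le_trans (onorm_triangle nrm (mG j _ t0) (mG0 j) mg) _.
exact: leeD.
Unshelve. all: by end_near. Qed.

End scattering.

Theorem corollary3p1p1 (R : realType) (n : nat) (I : interaction R n)
  (hI : mesoscopic I) (nrm : observers_norm I)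
  (f0 : phase R n -> R) (f : state R n)
  (hf : uniform_scattering_solution nrm f0 f)
  (N : R) (hN : N%:E = (nrm (f ^~ 0%R) + onorm_ext nrm (scattered I f 0%R))%E) :
  exists finf : state R n,
    [/\ scattering_limit nrm N f finf,
        forall g : state R n, scattering_limit nrm N f g ->
          {ae @lebesgue_phase R n, forall z, forall t, 0 <= t ->
             along g t z = along finf t z}
      & forall G : nat -> state R n, completed_scattering_limit nrm N f G ->
          scattering_norm nrm (fun z t => G k z t - finf z t) @[k --> \oo]
          --> 0%E].
Proof.
exists (free_transport (scattering_datum (I := I) f0 f)); split.
- exact: scattering_limit_free_transport.
- exact: scattering_limit_unique.
- exact: completed_scattering_limit_unique.
Qed.
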